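(* Let $f:\mathbb{N}\to\mathbb{N}$ be an unbounded non-decreasing function. Suppose there exists an integer $M\ge 2$ such that $f(Mn)\ge M f(n)$ for all $n\in\mathbb{N}$. Then there exists an elementary amenable lawless group $\Gamma$, generated by a finite set $S$, such that $\mathcal{A}_{\Gamma}^{S}\approx f$.
   Context: $\mathbb{N}=\{1,2,3,\dots\}$. For a group $\Gamma$ and the free group $F_k$ of rank $k$, a nontrivial $w\in F_k$ is a law for $\Gamma$ if $w(g_1,\dots,g_k)=e$ for all $g_1,\dots,g_k\in\Gamma$. $\Gamma$ is lawless if for some $k\ge 2$ (equivalently for all $k\ge1$) it has no law in $F_k$. Let $S$ be a generating set of $\Gamma$, $|\cdot|_S$ the word length on $\Gamma$, and $|\cdot|$ the word length on $F_k$ with respect to a fixed free basis. For a nontrivial $w\in F_k$ that is not a law for $\Gamma$, put $\chi_\Gamma^S(w)=\min\{\sum_{i=1}^k|g_i|_S : g_i\in\Gamma,\ w(g_1,\dots,g_k)\ne e\}$. For $\Gamma$ lawless and a fixed $k\ge 2$, the lawlessness growth is $\mathcal{A}_\Gamma^S(l)=\max\{\chi_\Gamma^S(w): w\in F_k\setminus\{1\},\ |w|\le l\}$ for $l\in\mathbb{N}$; up to the equivalence $\approx$ below it does not depend on the choice of $k\ge2$. For nondecreasing $F_1,F_2:\mathbb{N}\to\mathbb{N}$ write $F_1\preceq F_2$ if there is $K\in\mathbb{N}$ with $F_1(l)\le K F_2(Kl)$ for all $l\in\mathbb{N}$, and $F_1\approx F_2$ if $F_1\preceq F_2$ and $F_2\preceq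 F_1$. The class of elementary amenable groups is the smallest class containing all finite groups and $\mathbb{Z}$ and closed under subgroups, quotients, extensions and directed limits. *)

(* Defs.v *)
From mathcomp Require Import all_boot all_order all_algebra.
From mathcomp Require Import boolp classical_sets cardinality.

Set Implicit Arguments.
Unset Strict Implicit.
Unset Printing Implicit Defensive.

Local Open Scope classical_set_scope.
Local Open Scope group_scope.

(* Minimum and maximum of a set of natural numbers; both are the junk value 0
   when the minimum (the set is empty), respectively the maximum (the set is
   empty or unbounded), does not exist. *)
Definition min_nat (A : set nat) : nat :=
  xget 0%N [set n | A n /\ forall m, A m -> (n <= m)%N].
Definition max_nat (A : set nat) : nat :=
  xget 0%N [set n | A n /\ forall m, A m -> (m <= n)%N].

(* A letter (i, false) is the i-th element of the free basis, (i, true) is its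
   inverse.  An element of the free group of rank k is represented by its
   unique reduced word: the trivial element is [::], and the word length with
   respect to the basis is the size of the sequence. *)
Definition letter (k : nat) : Type := ('I_k * bool)%type.

Definition noncancelling (k : nat) : rel (letter k) :=
  fun a b => ~~ ((a.1 == b.1) && (a.2 != b.2)).

Definition free_group (k : nat) : Type :=
  {w : seq (letter k) | sorted (@noncancelling k) w}.

Definition free_length (k : nat) (w : free_group k) : nat := size (val w).

Definition nontrivial (k : nat) (w : free_group k) : Prop := val w <> [::].

Definition word_eval (G : groupType) (k : nat) (w : free_group k)
    (g : 'I_k -> G) : G :=
  \prod_(a <- val w) (if a.2 then (g a.1)^-1 else g a.1).

Definition is_law (G : groupType) (k : nat) (w : free_group k) : Prop :=
  nontrivial w /\ forall g : 'I_k -> G, word_eval w g = 1.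

Definition lawless (G : groupType) : Prop :=
  exists k : nat, (2 <= k)%N /\ forall w : free_group k, ~ is_law G w.

Definition is_product (G : groupType) (S : set G) (g : G) (s : seq G) : Prop :=
  (forall x : G, x \in s -> S x \/ S x^-1) /\ g = \prod_(x <- s) x.

Definition generates (G : groupType) (S : set G) : Prop :=
  forall g : G, exists s : seq G, is_product S g s.

Definition word_length (G : groupType) (S : set G) (g : G) : nat :=
  min_nat [set n | exists2 s : seq G, is_product S g s & size s = n].

Definition chi (G : groupType) (S : set G) (k : nat) (w : free_group k) : nat :=
  min_nat [set n | exists2 g : 'I_k -> G,
    word_eval w g <> 1 & (\sum_(i < k) word_length S (g i))%N = n].

Definition lawlessness_growth (G : groupType) (S : set G) (k l : nat) : nat :=
  max_nat [set n | exists2 w : free_group k,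
    nontrivial w /\ (free_length w <= l)%N & chi S w = n].

(* Functions on {1, 2, 3, ...} are represented by functions nat -> nat whose
   value at 0 is ignored. *)
Definition preceq (F1 F2 : nat -> nat) : Prop :=
  exists K : nat, (0 < K)%N /\
    forall l : nat, (0 < l)%N -> (F1 l <= K * F2 (K * l))%N.

Definition growth_equiv (F1 F2 : nat -> nat) : Prop :=
  preceq F1 F2 /\ preceq F2 F1.

(* The last two conditions say that G is the quotient of the
   disjoint union of the H i by the relation identifying x : H i with y : H j
   when they have the same image in some H m. *)
Definition is_directed_limit (I : Type) (le : I -> I -> Prop)
    (H : I -> groupType)
    (phi : forall i j : I, le i j -> {multiplicative H i -> H j})
    (G : groupType) (psi : forall i : I, {multiplicative H i -> G}) : Prop :=
  (forall i, le i i) /\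
  (forall i j m, le i j -> le j m -> le i m) /\
  (forall i j, exists m, le i m /\ le j m) /\
  (forall i (ii : le i i) x, phi i i ii x = x) /\
  (forall i j m (ij : le i j) (jm : le j m) (im : le i m) x,
      phi j m jm (phi i j ij x) = phi i m im x) /\
  (forall g : G, exists i, exists x : H i, psi i x = g) /\
  (forall i j (x : H i) (y : H j),
      psi i x = psi j y <->
      exists m (im : le i m) (jm : le j m), phi i m im x = phi j m jm y).

(* Subgroups and quotients are taken up to isomorphism, as sources of injective
   and targets of surjective homomorphisms. *)
Inductive elementary_amenable : groupType -> Prop :=
| EA_finite (G : groupType) :
    finite_set [set: G] -> elementary_amenable G
| EA_Z : elementary_amenable (Algebra.to_multiplicative int)
| EA_subgroup (G H : groupType) (i : {multiplicative H -> G}) :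
    injective i -> elementary_amenable G -> elementary_amenable H
| EA_quotient (G Q : groupType) (p : {multiplicative G -> Q}) :
    (forall q : Q, exists g : G, p g = q) ->
    elementary_amenable G -> elementary_amenable Q
| EA_extension (N G Q : groupType) (i : {multiplicative N -> G})
    (p : {multiplicative G -> Q}) :
    injective i ->
    (forall q : Q, exists g : G, p g = q) ->
    (forall g : G, p g = 1 <-> exists n : N, i n = g) ->
    elementary_amenable N -> elementary_amenable Q -> elementary_amenable G
| EA_directed_limit (I : Type) (le : I -> I -> Prop) (H : I -> groupType)
    (phi : forall i j : I, le i j -> {multiplicative H i -> H j})
    (G : groupType) (psi : forall i : I, {multiplicative H i -> G}) :
    is_directed_limit phi psi ->
    (forall i : I, elementary_amenable (H i)) -> elementary_amenable G.

(* Main.v *)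
From HB Require Import structures.
Require Import Defs.
From mathcomp Require Import all_boot all_order all_algebra.
From mathcomp Require Import boolp classical_sets cardinality.
From mathcomp Require Import zify.

(* Let L(n) be the length of a shortest law in F_2 of the groups solvable of
   length n.  Free groups are residually solvable, so L(n) > n, and if u is a
   law for length n then [u, z u z^-1] is one for length n + 1, so
   L(n+1) <= C L(n).  Put d(n) = f(L(n)).  For every n and every word w that is
   not a law of the groups of length n choose such a group A and a tuple
   g_1, ..., g_k in A with w(g_1, ..., g_k) <> 1, and let the group be generated
   by t and a in a diagonal product of unrestricted wreath products of these A
   by Z: t is the shift and a has the lamps g_j at the positions j d(n).

   Upper bound: the conjugates of a by the powers t^(j d(n)) have all the g_j at
   the origin, so a word of length less than c L(n) is nontrivial on a tuple of
   length O(d(n)).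
   Lower bound: elements of length much smaller than d(n+1) see at most one lamp
   of a near each position in the factors of level > n, so there the lamps of
   elements of the kernel to Z commute.  Hence [u(c_1, c_2), c_3], for u a
   shortest law of level n and c_i commutators of new variables, is trivial on
   tuples of length less than c d(n+1), while f(l) <= d(n+1) for l < L(n+1).

   Elementary amenability: a factor Z wr Z records the exponents with which the
   lamps of a are hit, so an element of the kernel of the projection to that
   factor is trivial in all factors of sufficiently high level; this kernel is
   an increasing union of solvable groups. *)

Set Implicit Arguments.
Unset Strict Implicit.
Unset Printing Implicit Defensive.
Import GRing.Theory.

Local Open Scope group_scope.

(** * Words, wreath products and residual solvability of free groups *)

Section PlainMorphisms.
Variables (G H : groupType) (p : G -> H).
Hypothesis pM : {morph p : x y / x * y}.

Lemma morph_one : p 1 = 1.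
Proof. by apply: (@mulIg _ (p 1)); rewrite -pM !mul1g. Qed.

Lemma morph_inv : {morph p : x / x^-1}.
Proof. by move=> x; apply: (@mulIg _ (p x)); rewrite -pM !mulVg morph_one. Qed.

Lemma to_multiplicative_of_morph :
  exists q : {multiplicative G -> H}, forall x, q x = p x.
Proof.
pose m := isMultiplicative.Build G H p pM.
pose q : {multiplicative G -> H} := HB.pack p m.
by exists q.
Qed.

End PlainMorphisms.

Section Words.
Variables (K : Type) (G : groupType) (g : K -> G).

Definition leval (a : K * bool) : G := if a.2 then (g a.1)^-1 else g a.1.

Definition eval (w : seq (K * bool)) : G := \prod_(a <- w) leval a.

Definition invl (a : K * bool) : K * bool := (a.1, ~~ a.2).
Definition invw (w : seq (K * bool)) : seq (K * bool) := rev (map invl w).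
Definition commw (u v : seq (K * bool)) := u ++ v ++ invw u ++ invw v.
Definition conjw (u v : seq (K * bool)) := u ++ v ++ invw u.

Lemma eval_nil : eval [::] = 1. Proof. exact: big_nil. Qed.

Lemma eval_cons a w : eval (a :: w) = leval a * eval w.
Proof. exact: big_cons. Qed.

Lemma eval_cat u v : eval (u ++ v) = eval u * eval v.
Proof. exact: big_cat. Qed.

Lemma eval_var x : eval [:: (x, false)] = g x.
Proof. by rewrite eval_cons eval_nil mulg1. Qed.

Lemma leval_inv a : leval (invl a) = (leval a)^-1.
Proof. by case: a => x [] //=; rewrite /leval /= invgK. Qed.

Lemma eval_inv w : eval (invw w) = (eval w)^-1.
Proof.
elim: w => [|a w IH]; first by rewrite eval_nil invg1.
rewrite /invw /= rev_cons -cats1 eval_cat IH !eval_cons eval_nil.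
by rewrite mulg1 leval_inv invgM.
Qed.

Lemma eval_comm u v :
  eval (commw u v) = eval u * (eval v * ((eval u)^-1 * (eval v)^-1)).
Proof. by rewrite !eval_cat !eval_inv. Qed.

Lemma eval_conj u v : eval (conjw u v) = eval u * (eval v * (eval u)^-1).
Proof. by rewrite !eval_cat eval_inv. Qed.

Lemma size_invw w : size (invw w) = size w.
Proof. by rewrite size_rev size_map. Qed.

Lemma size_commw u v : size (commw u v) = (size u + size v).*2.
Proof. by rewrite !size_cat !size_invw -addnn -!addnA. Qed.

Lemma size_conjw u v : size (conjw u v) = ((size u).*2 + size v)%N.
Proof. by rewrite !size_cat size_invw -addnn addnA addnAC. Qed.

End Words.

Lemma eval_ext (K : Type) (G : groupType) (g h : K -> G) w :
  g =1 h -> eval g w = eval h w.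
Proof. by move=> gh; apply: eq_bigr => a _; rewrite /leval gh. Qed.

Lemma eval_morph (K : Type) (G H : groupType) (p : G -> H) (g : K -> G) w :
  {morph p : x y / x * y} -> p (eval g w) = eval (p \o g) w.
Proof.
move=> pM; elim: w => [|a w IH]; first by rewrite !eval_nil morph_one.
rewrite !eval_cons pM IH; congr (_ * _).
by rewrite /leval; case: a.2 => //=; rewrite morph_inv.
Qed.

Definition substw (K L : Type) (s : K -> seq (L * bool)) (w : seq (K * bool)) :=
  flatten [seq if a.2 then invw (s a.1) else s a.1 | a <- w].

Lemma eval_subst (K L : Type) (G : groupType) (g : L -> G)
    (s : K -> seq (L * bool)) w :
  eval g (substw s w) = eval (fun x => eval g (s x)) w.
Proof.
elim: w => [|a w IH]; first by rewrite !eval_nil.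
rewrite /substw /= eval_cat -/(substw s w) IH eval_cons; congr (_ * _).
by rewrite /leval; case: a.2; rewrite ?eval_inv.
Qed.

Lemma size_substw (K L : Type) (s : K -> seq (L * bool)) c w :
  (forall x, (size (s x) <= c)%N) -> (size (substw s w) <= c * size w)%N.
Proof.
move=> sc; elim: w => [|a w IH] //=.
rewrite /substw /= size_cat mulnS leq_add //.
by case: a.2; rewrite ?size_invw.
Qed.

(** Induction on [w]: a new first letter either keeps the reduced word reduced or cancels against
    its head. *)
Lemma free_reduction (k : nat) (w : seq (letter k)) :
  exists w' : free_group k, (free_length w' <= size w)%N /\
    forall (G : groupType) (g : 'I_k -> G), word_eval w' g = eval g w.
Proof.
suff [u [us ul ue]] : exists u : seq (letter k),
    [/\ sorted (@noncancelling k) u, (size u <= size w)%N &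
      forall (G : groupType) (g : 'I_k -> G), eval g u = eval g w].
  by exists (exist _ u us).
elim: w => [|a w [u [us ul ue]]]; first by exists [::].
case: u us ul ue => [|b u] us ul ue.
  exists [:: a]; split=> // G g.
  by rewrite eval_cons ue -eval_cons.
case ab: (noncancelling a b).
  exists [:: a, b & u]; split; [by rewrite /= ab | by [] |] => G g.
  by rewrite eval_cons ue -eval_cons.
exists u; split; first by exact: path_sorted us.
  by rewrite ltnW // ltnW.
move=> G g; rewrite eval_cons -ue eval_cons mulgA.
suff -> : leval g a = (leval g b)^-1 by rewrite mulVg mul1g.
move/negbFE: ab; rewrite /noncancelling -leval_inv.
case: a b us {ul ue} => [x e] [y d] _ /= /andP[/eqP-> ed].
by congr (leval _ (_, _)); case: e d ed => [] [].
Qed.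

Section Wreath.
Variables (B : groupType) (I : Type) (A : I -> groupType).

(** No support condition is imposed, and all lamp groups share one base, so a single [wreath]
    contains a diagonal product. In a product, [lamps u i x] collects the lamps met along a walk
    that starts at [x] and moves by the base components. *)
Record wreath := Wreath { base : B; lamps : forall i, B -> A i }.

HB.instance Definition _ := gen_eqMixin wreath.
HB.instance Definition _ := gen_choiceMixin wreath.

Lemma wreathP (u v : wreath) :
  base u = base v -> (forall i x, lamps u i x = lamps v i x) -> u = v.
Proof.
case: u v => [b f] [c h] /= -> fh; congr Wreath.
by apply: functional_extensionality_dep => i; apply/funext => x.
Qed.

Definition wreath_mul u v :=
  Wreath (base u * base v) (fun i x => lamps u i x * lamps v i (x * base u)).
Definition wreath_one := Wreath 1 (fun i x => 1).
Definition wreath_inv u :=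
  Wreath (base u)^-1 (fun i x => (lamps u i (x * (base u)^-1))^-1).

Lemma wreath_mulA : associative wreath_mul.
Proof. by move=> u v w; apply: wreathP => [|i x] /=; rewrite !mulgA. Qed.
Lemma wreath_mul1 : left_id wreath_one wreath_mul.
Proof. by move=> u; apply: wreathP => [|i x] /=; rewrite ?mulg1 mul1g. Qed.
Lemma wreath_mulr1 : right_id wreath_one wreath_mul.
Proof. by move=> u; apply: wreathP => [|i x] /=; rewrite mulg1. Qed.
Lemma wreath_mulV : left_inverse wreath_one wreath_inv wreath_mul.
Proof. by move=> u; apply: wreathP => [|i x] /=; rewrite mulVg. Qed.
Lemma wreath_mulrV : right_inverse wreath_one wreath_inv wreath_mul.
Proof. by move=> u; apply: wreathP => [|i x] /=; rewrite ?mulgK mulgV. Qed.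

HB.instance Definition _ := isGroup.Build wreath
  wreath_mulA wreath_mul1 wreath_mulr1 wreath_mulV wreath_mulrV.

Lemma baseM : {morph base : u v / u * v}. Proof. by []. Qed.
Lemma baseV u : base u^-1 = (base u)^-1. Proof. by []. Qed.
Lemma lampsM u v i x :
  lamps (u * v) i x = lamps u i x * lamps v i (x * base u).
Proof. by []. Qed.
Lemma lamps1 i x : lamps 1 i x = 1. Proof. by []. Qed.
Lemma lampsV u i x : lamps u^-1 i x = (lamps u i (x * (base u)^-1))^-1.
Proof. by []. Qed.

Lemma base_eval (K : Type) (g : K -> wreath) w :
  base (eval g w) = eval (base \o g) w.
Proof. exact: eval_morph baseM. Qed.

Lemma lamps_eval (K : Type) (g : K -> wreath) w i x :
  (forall y, base (g y) = 1) ->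
  lamps (eval g w) i x = eval (fun y => lamps (g y) i x) w.
Proof.
move=> g1; elim: w x => [|a w IH] x; first by rewrite !eval_nil.
rewrite !eval_cons lampsM.
have -> : base (leval g a) = 1.
  by rewrite /leval; case: a.2; rewrite ?baseV g1 ?invg1.
rewrite mulg1 IH; congr (_ * _); rewrite /leval; case: a.2 => //.
by rewrite lampsV g1 invg1 mulg1.
Qed.

End Wreath.

(** Derived length at most [n]. The map [p] is any homomorphism with commutative kernel, so no
    derived series or quotient group has to be built. *)
Fixpoint solvable_of_length (n : nat) (G : groupType) : Prop :=
  if n is m.+1 then
    exists (Q : groupType) (p : G -> Q), {morph p : x y / x * y} /\
      (forall x y, p x = 1 -> p y = 1 -> commute x y) /\
      solvable_of_length m Q
  else forall x : G, x = 1.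

Lemma solvableS n G : solvable_of_length n G -> solvable_of_length n.+1 G.
Proof.
elim: n G => [|n IH] G.
  move=> G1; exists G, idfun; split=> //; split=> // x y _ _.
  by rewrite (G1 x); apply/commute_sym/commute1.
by case=> [Q [p [pM [pC /IH Qs]]]]; exists Q, p.
Qed.

Lemma solvable_le m n G :
  (m <= n)%N -> solvable_of_length m G -> solvable_of_length n G.
Proof. by move=> /subnK<- sG; elim: (n - m)%N => // d; apply: solvableS. Qed.

Notation intg := (Algebra.to_multiplicative int).

Lemma solvable_wreath n (B : groupType) (I : Type) (A : I -> groupType) :
  (forall i (x y : A i), commute x y) ->
  solvable_of_length n B -> solvable_of_length n.+1 (wreath B A).
Proof.
move=> AC sB; exists B, (@base B I A); split=> //; split=> // u v u1 v1.
apply: wreathP => [|i x]; first by rewrite !baseM u1 v1.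
by rewrite !lampsM u1 v1 !mulg1; apply: AC.
Qed.

Definition trivial_group : groupType := {ffun void -> intg}.

Lemma trivial_groupP (x y : trivial_group) : x = y.
Proof. by apply/ffunP; case. Qed.

Section Magnus.
Variables (k : nat) (G : groupType) (g : 'I_k -> G).

(** With these lamps, coordinate [i] of a word at [x] is the signed number of times that its path
    from [x] in the Cayley graph crosses the edge labelled [i] leaving 1. *)
Definition magnus_lamp (j i : 'I_k) (x : G) : intg :=
  if (i == j) && (x == 1) then 1%R else 0%R.

Definition magnus (j : 'I_k) : wreath G (fun _ : 'I_k => intg) :=
  Wreath (g j) (magnus_lamp j).

(** The hypothesis says that the path never crosses the edge labelled [i] leaving 1, in either
    direction. *)
Lemma magnus_unvisited (w : seq (letter k)) i x :
  (forall u b v, w = u ++ b :: v -> b.1 = i ->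
     x * eval g u * (if b.2 then (g i)^-1 else 1) != 1) ->
  lamps (eval magnus w) i x = 1.
Proof.
elim: w x => [|a w IH] x H; first by rewrite eval_nil.
rewrite eval_cons lampsM.
rewrite IH => [|u b v wE bi]; last first.
  suff -> : base (leval magnus a) = leval g a.
    by have := H (a :: u) b v; rewrite eval_cons wE mulgA; exact.
  by rewrite /leval; case: a.2.
rewrite mulg1.
have := H [::] a w erefl; rewrite eval_nil mulg1 /leval.
case: a {H IH} => j [] /= H.
  rewrite ?lampsV /= /magnus_lamp; case: eqP => //= ij.
  by rewrite -ij (negbTE (H (esym ij))); exact: (@invg1 intg).
rewrite /magnus_lamp; case: eqP => //= ij.
by move: (H (esym ij)); rewrite mulg1 => /negbTE->.
Qed.

(* If all shorter reduced words are nontrivial on g and w is trivial, then w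
   runs through a simple loop in the Cayley graph; the lamp of the wreath
   product recording the signed traversals of its first edge is then +-1. *)
Lemma magnus_faithful (l : nat) :
  (forall w : seq (letter k), sorted (@noncancelling k) w ->
     (0 < size w <= l)%N -> eval g w != 1) ->
  forall w : seq (letter k), sorted (@noncancelling k) w ->
     (0 < size w <= l.+1)%N -> eval magnus w != 1.
Proof.
move=> Hl [//|a v] ws wl; apply/eqP => w1.
have gw1 : eval g (a :: v) = 1.
  by have := congr1 (@base _ _ _) w1; rewrite base_eval.
have nz : forall u, sorted (@noncancelling k) u -> (0 < size u <= l)%N ->
    eval g u <> 1 by move=> u us ul; apply/eqP/Hl.
case: a ws wl w1 gw1 => i [] ws wl w1 gw1.
  (* Started at [g i], the path crosses the edge from 1 to [g i] backwards at once. A second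
     crossing would yield a cancellation in the word or a nonempty reduced subword of length at most
     [l] that is trivial on [g]. *)
  have := congr1 (fun u => lamps u i (g i)) w1.
  rewrite eval_cons lampsM magnus_unvisited.
    by rewrite mulg1 /leval /= /= mulgV /magnus_lamp !eqxx.
  move=> u b v' vE bi; rewrite /leval /= mulgV mul1g.
  rewrite vE in ws wl gw1; apply/eqP.
  have us : sorted (@noncancelling k) (u ++ [:: b]).
    move: ws => /(@cat_sorted2 _ _ [:: (i, true)] (u ++ b :: v')) [_].
    by rewrite -cat_rcons -cats1 => /cat_sorted2[].
  have ul : (size (u ++ [:: b]) <= l)%N.
    move: wl; rewrite /= !size_cat /= ltnS addnS addn1.
    by apply: leq_trans; rewrite ltnS leq_addr.
  case: b bi us ul ws {wl gw1 vE} => j [] /= ji us ul ws.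
    rewrite -ji => e; apply: (nz _ us); first by rewrite ul size_cat addn1.
    by rewrite eval_cat eval_cons eval_nil mulg1.
  rewrite mulg1 => e; case: u us ul e ws => [|c u] us ul e ws.
    by move: ws; rewrite /noncancelling /= ji eqxx.
  apply: (nz _ _ _ e); first by case/cat_sorted2: us.
  by move: ul; rewrite size_cat addn1 => /ltnW->.
have := congr1 (fun u => lamps u i 1) w1.
rewrite eval_cons lampsM magnus_unvisited.
  by rewrite mulg1 /leval /= /magnus_lamp !eqxx.
move=> u b v' vE bi; rewrite /leval /= mul1g.
rewrite vE in ws wl gw1; apply/eqP => e.
have as_ : sorted (@noncancelling k) ((i, false) :: u).
  by move: ws; rewrite -cat_cons => /cat_sorted2[].
have al : (size u < l)%N.
  move: wl; rewrite /= ltnS size_cat /= addnS; apply: leq_trans.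
  by rewrite ltnS leq_addr.
case: b bi e ws wl gw1 {vE} => j [] /= ji e ws wl gw1; last first.
  by apply: (nz _ as_); rewrite //= eval_cons /leval /= -e mulg1.
(* If the backward crossing is the last letter, no proper prefix is available; but then the word is
   a conjugate of [u], and [u] is the shorter trivial word. *)
case: v' ws wl gw1 => [|c v'] ws wl gw1; last first.
  apply: (nz (((i, false) :: u) ++ [:: (i, true)])).
  - suff: sorted (@noncancelling k) (((i, false) :: u ++ [:: (i, true)]) ++ c :: v').
      by case/cat_sorted2.
    by rewrite /= -catA /= -[in (i, true)]ji.
  - move: wl; rewrite /= !size_cat /= !addnS addn0 ltnS.
    by apply: leq_trans; rewrite !ltnS leq_addr.
  by rewrite eval_cat !eval_cons eval_nil /leval /= mulg1.
case: u as_ al ws gw1 {e wl} => [|c u] as_ al ws gw1.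
  by move: ws; rewrite /= /noncancelling /= ji eqxx.
apply: (nz (c :: u)); first by exact: path_sorted as_.
  by rewrite /= ltnW.
move: gw1; rewrite eval_cons eval_cat [eval g [:: _]]eval_cons eval_nil.
rewrite /leval /= ji mulg1 => /(congr1 (fun x => (g i)^-1 * x * g i)).
by rewrite mulKg mulgVK mulg1 mulVg.
Qed.

End Magnus.

(** Iterating the wreath construction from the trivial group, each step raises by one both the
    solvable length and the length of the words detected. *)
Lemma residually_solvable k l : exists (G : groupType) (g : 'I_k -> G),
  solvable_of_length l G /\
  forall w : seq (letter k), sorted (@noncancelling k) w ->
     (0 < size w <= l)%N -> eval g w != 1.
Proof.
elim: l => [|l [G [g [sG Hg]]]].
  exists trivial_group, (fun=> 1); split; first by move=> x; apply: trivial_groupP.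
  by move=> w _ /andP[/leq_trans H /H].
exists (wreath G (fun _ : 'I_k => intg)), (magnus g); split.
  by apply: solvable_wreath => // _ x y; apply: addrC.
exact: magnus_faithful.
Qed.

(** * Elementary amenability of solvable groups *)

Definition zexp (G : groupType) (x : G) (z : int) : G :=
  if z is Negz n then x ^- n.+1 else x ^+ `|z|%N.

Lemma zexpS (G : groupType) (x : G) z : zexp x (z + 1)%R = x * zexp x z.
Proof.
case: z => [n|[|n]]; first by rewrite /= addn1 expgS.
  by rewrite /= expg1 mulgV.
have -> : (Negz n.+1 + 1)%R = Negz n.
  by rewrite !NegzE -[in LHS]addn1 PoszD opprD subrK.
by rewrite /= [x ^+ n.+2]expgSr invgM mulVKg.
Qed.

Lemma zexpM (G : groupType) (x : G) :
  {morph zexp x : a b / (a + b)%R >-> a * b}.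
Proof.
move=> a b; elim/int_ind: a => [|n IH|n IH]; first by rewrite add0r mul1g.
  by rewrite -addn1 PoszD addrAC !zexpS IH mulgA.
apply: (@mulgI _ x); rewrite -zexpS mulgA -zexpS.
by rewrite -addn1 PoszD opprD addrAC subrK IH.
Qed.

Section Subgroups.
Variable G : groupType.

Record subgroup := Subgroup {
  mem_sub :> G -> Prop;
  mem_sub1 : mem_sub 1;
  mem_subM : forall x y, mem_sub x -> mem_sub y -> mem_sub (x * y);
  mem_subV : forall x, mem_sub x -> mem_sub x^-1 }.

Record sub_group (S : subgroup) := InSubgroup { sub_val :> G; sub_valP : S sub_val }.

Section Sub.
Variable S : subgroup.

HB.instance Definition _ := gen_eqMixin (sub_group S).
HB.instance Definition _ := gen_choiceMixin (sub_group S).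

Lemma sub_val_inj : injective (@sub_val S).
Proof.
by case=> [x Sx] [y Sy] /= xy; subst y; congr InSubgroup; apply: Prop_irrelevance.
Qed.

Definition sub_mul (x y : sub_group S) :=
  InSubgroup (mem_subM (sub_valP x) (sub_valP y)).
Definition sub_one : sub_group S := InSubgroup (mem_sub1 S).
Definition sub_inv (x : sub_group S) := InSubgroup (mem_subV (sub_valP x)).

Lemma sub_mulA : associative sub_mul.
Proof. by move=> x y z; apply: sub_val_inj; apply: mulgA. Qed.
Lemma sub_mul1 : left_id sub_one sub_mul.
Proof. by move=> x; apply: sub_val_inj; apply: mul1g. Qed.
Lemma sub_mulr1 : right_id sub_one sub_mul.
Proof. by move=> x; apply: sub_val_inj; apply: mulg1. Qed.
Lemma sub_mulV : left_inverse sub_one sub_inv sub_mul.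
Proof. by move=> x; apply: sub_val_inj; apply: mulVg. Qed.
Lemma sub_mulrV : right_inverse sub_one sub_inv sub_mul.
Proof. by move=> x; apply: sub_val_inj; apply: mulgV. Qed.

HB.instance Definition _ := isGroup.Build (sub_group S)
  sub_mulA sub_mul1 sub_mulr1 sub_mulV sub_mulrV.

Lemma sub_valM : {morph @sub_val S : x y / x * y}. Proof. by []. Qed.

End Sub.

Definition sub_incl (S T : subgroup) (ST : forall x, S x -> T x)
  (x : sub_group S) : sub_group T := InSubgroup (ST _ (sub_valP x)).

Lemma sub_inclM (S T : subgroup) (ST : forall x, S x -> T x) :
  {morph sub_incl ST : x y / x * y}.
Proof. by move=> x y; apply: sub_val_inj. Qed.

End Subgroups.

HB.instance Definition _ (G : groupType) (S : subgroup G) :=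
  isMultiplicative.Build (sub_group S) G (@sub_val G S) (@sub_valM G S).
HB.instance Definition _ (G : groupType) (S T : subgroup G)
    (ST : forall x, S x -> T x) :=
  isMultiplicative.Build (sub_group S) (sub_group T) (sub_incl ST) (sub_inclM ST).

Lemma ea_sub (G H : groupType) (p : H -> G) :
  {morph p : x y / x * y} -> injective p ->
  elementary_amenable G -> elementary_amenable H.
Proof.
move=> /to_multiplicative_of_morph[q qE] pI; apply: (@EA_subgroup _ _ q).
by move=> x y; rewrite !qE => /pI.
Qed.

Lemma ea_quotient (G H : groupType) (p : G -> H) :
  {morph p : x y / x * y} -> (forall y, exists x, p x = y) ->
  elementary_amenable G -> elementary_amenable H.
Proof.
move=> /to_multiplicative_of_morph[q qE] pS; apply: (@EA_quotient _ _ q).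
by move=> y; have [x <-] := pS y; exists x.
Qed.

Definition ker_sub (G H : groupType) (p : G -> H)
  (pM : {morph p : x y / x * y}) : subgroup G.
Proof.
exists (fun x => p x = 1); first exact: morph_one.
- by move=> x y /= px py; rewrite pM px py mulg1.
- by move=> x /= px; rewrite morph_inv // px invg1.
Defined.

Definition range_sub (G H : groupType) (p : G -> H)
  (pM : {morph p : x y / x * y}) : subgroup H.
Proof.
exists (fun y => exists x, p x = y); first by exists 1; apply: morph_one.
- by move=> _ _ [x <-] [y <-]; exists (x * y); rewrite pM.
- by move=> _ [x <-]; exists x^-1; rewrite morph_inv.
Defined.

(** As [p] may fail to be onto, [G] is an extension by the range of [p], which inherits elementary
    amenability from [H]. *)
Lemma ea_kernel (G H : groupType) (p : G -> H) (pM : {morph p : x y / x * y}) :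
  elementary_amenable (sub_group (ker_sub pM)) -> elementary_amenable H ->
  elementary_amenable G.
Proof.
move=> eaK eaH.
pose r (x : G) : sub_group (range_sub pM) :=
  @InSubgroup _ (range_sub pM) (p x) (ex_intro _ x erefl).
have rM : {morph r : x y / x * y} by move=> x y; apply: sub_val_inj; apply: pM.
have [q qE] := to_multiplicative_of_morph rM.
apply: (@EA_extension _ _ (sub_group (range_sub pM))
  (@sub_val _ (ker_sub pM) : {multiplicative _ -> _}) q) => //.
- exact: sub_val_inj.
- move=> [y [x xy]]; exists x; rewrite qE; exact: sub_val_inj.
- move=> g; rewrite qE; split=> [/(congr1 (@sub_val _ _)) /= pg|[n <-]].
    by exists (@InSubgroup _ (ker_sub pM) g pg).
  by apply: sub_val_inj; apply: (sub_valP n).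
- by apply: (ea_sub (@sub_valM _ _)) eaH; apply: sub_val_inj.
Qed.

Lemma ea_prod (G H : groupType) :
  elementary_amenable G -> elementary_amenable H -> elementary_amenable (G * H)%type.
Proof.
move=> eaG eaH.
have fM : {morph (@fst G H) : x y / x * y} by [].
apply: (ea_kernel (pM := fM)) eaG.
pose s (x : sub_group (ker_sub fM)) : H := (sub_val x).2.
apply: (@ea_sub _ _ s) eaH => [x y //|[[a b] /= a1] [[c d] /= c1] e].
by apply: sub_val_inj; rewrite /= a1 c1; congr (_, _).
Qed.

Lemma ea_trivial (G : groupType) : (forall x : G, x = 1) -> elementary_amenable G.
Proof.
move=> G1; apply: EA_finite; apply: (sub_finite_set (B := [set 1])) => [x _ /=|].
  exact: G1.
exact: finite_set1.
Qed.

Lemma ea_directed_union (G : groupType) (I : Type) (S : I -> subgroup G) :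
  (forall i j, exists m, (forall x, S i x -> S m x) /\ (forall x, S j x -> S m x)) ->
  (forall x, exists i, S i x) ->
  (forall i, elementary_amenable (sub_group (S i))) -> elementary_amenable G.
Proof.
move=> dirS covS eaS.
apply: (@EA_directed_limit I (fun i j => forall x, S i x -> S j x)
  (fun i => sub_group (S i))
  (fun i j ij => sub_incl ij : {multiplicative _ -> _}) G
  (fun i => @sub_val _ (S i) : {multiplicative _ -> _})) => //.
split; first by [].
split; first by move=> i j m ij jm x /ij/jm.
split; first exact: dirS.
split; first by move=> i ii x; apply: sub_val_inj.
split; first by move=> i j m ij jm im x; apply: sub_val_inj.
split; first by move=> x; have [i Sx] := covS x; exists i, (InSubgroup Sx).
move=> i j x y; split=> [xy|[m [im [jm /(congr1 (@sub_val _ _))]]] //].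
have [m [im jm]] := dirS i j; exists m, im, jm; exact: sub_val_inj.
Qed.

Definition generated_sub (G : groupType) (s : seq G) : subgroup G.
Proof.
exists (fun x => forall T : subgroup G, (forall y, y \in s -> T y) -> T x).
- by move=> T _; apply: mem_sub1.
- by move=> x y /= Hx Hy T Ts; apply: mem_subM; [apply: Hx | apply: Hy].
- by move=> x /= Hx T Ts; apply: mem_subV; apply: Hx.
Defined.

(** The group is the directed union of its finitely generated subgroups, and adjoining a generator
    [x] gives a quotient of the product of Z with the previous subgroup. *)
Lemma ea_abelian (G : groupType) :
  (forall x y : G, commute x y) -> elementary_amenable G.
Proof.
move=> GC; apply: (@ea_directed_union _ (seq G) (@generated_sub G)).
- move=> s t; exists (s ++ t); split=> x Hx T Ts; apply: Hx => y ys; apply: Ts;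
    by rewrite mem_cat ys ?orbT.
- by move=> x; exists [:: x] => T; apply; rewrite inE.
elim=> [|x s IH].
  apply: ea_trivial => -[x Sx]; apply: sub_val_inj => /=.
  (* The kernel of the identity is the trivial subgroup; it contains every element of the empty
     list. *)
  by apply: (Sx (ker_sub (fun a b : G => erefl (id a * id b)))).
have Sz z : generated_sub (x :: s) (zexp x z).
  have Sx : generated_sub (x :: s) x by move=> T; apply; rewrite inE eqxx.
  elim/int_ind: z => [|n IHn|n IHn]; first exact: mem_sub1.
    by rewrite -addn1 PoszD zexpS; apply: mem_subM.
  have -> : zexp x (- n.+1%:Z)%R = x^-1 * zexp x (- n%:Z)%R.
    by apply: (@mulgI _ x); rewrite -zexpS mulVKg -addn1 PoszD opprD subrK.
  by apply: mem_subM => //; apply: mem_subV.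
have Ss h : generated_sub s h -> generated_sub (x :: s) h.
  by move=> Hh T Ts; apply: Hh => y ys; apply: Ts; rewrite inE ys orbT.
pose p (u : intg * sub_group (generated_sub s)) :
    sub_group (generated_sub (x :: s)) :=
  InSubgroup (mem_subM (Sz u.1) (Ss _ (sub_valP u.2))).
have pM : {morph p : u v / u * v}.
  move=> [a g] [b h]; apply: sub_val_inj => /=.
  rewrite [zexp x _]zexpM !mulgA; congr (_ * _); rewrite -!mulgA; congr (_ * _).
  exact: GC.
apply: (ea_quotient pM); last by apply: ea_prod => //; exact: EA_Z.
move=> [y Sy]; have qM : {morph (@sub_val _ _ \o p) : u v / u * v}.
  by move=> u v; apply: (congr1 (@sub_val _ _) (pM u v)).
have [u uy] : range_sub qM y.
  apply: Sy => z; rewrite inE => /predU1P[->|zs].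
    by exists (1%R : intg, 1); rewrite /= mulg1.
  have Sz' : generated_sub s z by move=> T; apply.
  by exists (0%R : intg, InSubgroup Sz'); rewrite /= mul1g.
by exists u; apply: sub_val_inj.
Qed.

Lemma ea_solvable n (G : groupType) :
  solvable_of_length n G -> elementary_amenable G.
Proof.
elim: n G => [G|n IH G [Q [p [pM [pC /IH eaQ]]]]]; first exact: ea_trivial.
apply: (ea_kernel (pM := pM)) eaQ; apply: ea_abelian => x y.
by apply: sub_val_inj; apply: pC; [apply: (sub_valP x)|apply: (sub_valP y)].
Qed.

(** * Shortest laws of solvable groups *)

(** The product of the groups [Q i] is realised as a wreath product over the trivial base. The
    kernel of the map to it commutes coordinatewise, and the coordinates of the product separate its
    points, which feeds the induction. *)
Lemma solvable_separated n (G : groupType) (I : Type) (A : I -> groupType)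
    (p : forall i, G -> A i) :
  (forall i, {morph p i : x y / x * y}) ->
  (forall x, (forall i, p i x = 1) -> x = 1) ->
  (forall i, solvable_of_length n (A i)) -> solvable_of_length n G.
Proof.
elim: n G I A p => [|n IH] G I A p pM pI sA.
  by move=> x; apply: pI => i; apply: sA.
pose Q i := sval (cid (sA i)).
pose q i : A i -> Q i := sval (cid (svalP (cid (sA i)))).
have qP : forall i, {morph q i : x y / x * y} /\
    (forall x y, q i x = 1 -> q i y = 1 -> commute x y) /\
    solvable_of_length n (Q i).
  by move=> i; apply: (svalP (cid (svalP (cid (sA i))))).
pose r x := Wreath (1 : trivial_group) (fun i _ => q i (p i x)).
exists (wreath trivial_group Q), r; split; [|split].
- by move=> x y; apply: wreathP => [|i z] /=; rewrite ?mulg1 // pM (qP i).1.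
- move=> x y rx ry; apply: divg1_eq; apply: pI => i.
  have rq u : r u = 1 -> q i (p i u) = 1.
    by move=> /(congr1 (fun u => lamps u i 1)).
  have := (qP i).2.1 _ _ (rq _ rx) (rq _ ry); rewrite /commute.
  by rewrite !(pM, morph_inv (pM i)) => ->; rewrite mulgV.
apply: (IH _ I Q (fun i u => lamps u i 1)) => [i u v|u u1|i].
- by rewrite lampsM; congr (_ * lamps v i _); apply: trivial_groupP.
- apply: wreathP => [|i z]; first exact: trivial_groupP.
  by rewrite (trivial_groupP z 1) u1.
- by have [_ [_ ?]] := qP i.
Qed.

(** * Translations, spread lamps and substitution into two variables *)

Section Translations.
Variables (B : groupType) (I : Type) (A : I -> groupType).

Definition wbase (b : B) : wreath B A := Wreath b (fun _ _ => 1).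

Lemma wbaseM : {morph wbase : x y / x * y}.
Proof. by move=> x y; apply: wreathP => //= i z; rewrite mulg1. Qed.

Lemma wbaseX b n : wbase (b ^+ n) = wbase b ^+ n.
Proof.
elim: n => [|n IH]; first by apply: wreathP.
by rewrite !expgS wbaseM IH.
Qed.

Lemma lamps_conj b (u : wreath B A) i x :
  lamps (wbase b * (u * (wbase b)^-1)) i x = lamps u i (x * b).
Proof. by rewrite !lampsM lampsV /= invg1 mulg1 mul1g. Qed.

End Translations.

Section Spread.
Variables (K : finType) (G : groupType) (g : K -> G) (d : nat).

Definition spread (p : intg) : G :=
  if [pick j : K | p == Posz (enum_rank j * d)] is Some j then g j else 1.

Lemma spreadE j : (0 < d)%N -> spread (Posz (enum_rank j * d)) = g j.
Proof.
move=> d0; rewrite /spread; case: pickP => [i|/(_ j)]; last by rewrite eqxx.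
rewrite eqz_nat eqn_mul2r eqn0Ngt d0 /= => /eqP/val_inj/enum_rank_inj.
by move->.
Qed.

Lemma spread_neq1 p : spread p <> 1 -> exists m : nat, p = Posz (m * d).
Proof.
by rewrite /spread; case: pickP => // j /eqP-> _; exists (enum_rank j).
Qed.

End Spread.

Lemma intg_exp (n : nat) : (1%R : intg) ^+ n = Posz n.
Proof. by elim: n => // n IH; rewrite expgS IH. Qed.

Lemma eval_nseq (K : Type) (G : groupType) (g : K -> G) x n :
  eval g (nseq n (x, false)) = g x ^+ n.
Proof.
by elim: n => [|n IH] /=; rewrite ?eval_nil // eval_cons IH expgS.
Qed.

(** The conjugates y^j x y^-j are free generators, so substituting them reduces finitely many
    variables to two at the cost of a bounded factor in length. *)
Definition theta (K : finType) (L : Type) (x y : L) (j : K) : seq (L * bool) :=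
  conjw (nseq (enum_rank j) (y, false)) [:: (x, false)].

Lemma size_theta (K : finType) (L : Type) (x y : L) (j : K) :
  (size (theta x y j) <= 2 * #|K|)%N.
Proof.
rewrite size_conjw size_nseq addn1 mul2n.
by rewrite (leq_trans (n := (enum_rank j).+1.*2)) // leq_double ltn_ord.
Qed.

Lemma eval_theta (K : finType) (L : Type) (x y : L) (G : groupType) (g : L -> G)
    (j : K) :
  eval g (theta x y j) = g y ^+ enum_rank j * (g x * (g y ^+ enum_rank j)^-1).
Proof. by rewrite eval_conj eval_nseq eval_var. Qed.

(** Nontriviality in the free group, stated semantically so that it applies to words that are not
    reduced. *)
Definition nontrivial_word (K : Type) (w : seq (K * bool)) : Prop :=
  exists (G : groupType) (g : K -> G), eval g w <> 1.

(** Take the shift for [y] and the lamps [g j] at the positions 0, 1, 2, ... for [x]: the word with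
    index [j] then carries [g j] at the origin. *)
Lemma nontrivial_theta (K : finType) (L : eqType) (x y : L) (w : seq (K * bool)) :
  x != y -> nontrivial_word w -> nontrivial_word (substw (theta x y) w).
Proof.
move=> xy [G [g gw]].
pose W := wreath intg (fun _ : unit => G).
pose h z : W :=
  if z == y then wbase _ (1%R : intg) else Wreath (1 : intg) (fun _ => spread g 1).
exists W, h; rewrite eval_subst => e; apply: gw.
have := congr1 (fun u : W => lamps u tt 1) e; rewrite lamps_eval.
  rewrite lamps1 => gw; rewrite -[RHS]gw; apply: eval_ext => j; rewrite eval_theta.
  rewrite /h eqxx (negbTE xy) -wbaseX lamps_conj /=.
  by rewrite mul1g intg_exp -(spreadE g j (ltn0Sn 0)) muln1.
move=> j; rewrite eval_theta baseM baseM baseV /h (negbTE xy) eqxx -wbaseX /=.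
by rewrite mul1g mulgV.
Qed.

Lemma nontrivial_free (k : nat) (w : seq (letter k)) :
  nontrivial_word w -> exists w' : free_group k,
    [/\ nontrivial w', (free_length w' <= size w)%N &
      forall (G : groupType) (g : 'I_k -> G), word_eval w' g = eval g w].
Proof.
move=> [G [g gw]]; have [w' [w'l w'e]] := free_reduction w.
exists w'; split=> // w'0; apply: gw.
by rewrite -w'e /word_eval w'0 big_nil.
Qed.

Lemma free_nontrivial_solvable (k : nat) (w : free_group k) n :
  nontrivial w -> (free_length w <= n)%N ->
  exists (G : groupType) (g : 'I_k -> G),
    solvable_of_length n G /\ eval g (val w) <> 1.
Proof.
move=> w0 wn; have [G [g [sG Hg]]] := residually_solvable k n.
exists G, g; split=> //; apply/eqP/Hg; first exact: (valP w).
by rewrite wn andbT lt0n size_eq0; apply/eqP.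
Qed.

Lemma free_nontrivial_word (k : nat) (w : free_group k) :
  nontrivial w -> nontrivial_word (val w).
Proof.
by move=> /free_nontrivial_solvable/(_ (leqnn _))[G [g [_ ?]]]; exists G, g.
Qed.

Lemma free_theta (K : finType) (k : nat) (x y : 'I_k) (w : seq (K * bool)) :
  x != y -> nontrivial_word w -> exists w' : free_group k,
    [/\ nontrivial w', (free_length w' <= 2 * #|K| * size w)%N &
      forall (G : groupType) (g : 'I_k -> G),
        word_eval w' g = eval (fun j => eval g (theta x y j)) w].
Proof.
move=> xy /(nontrivial_theta xy)/nontrivial_free[w' [w'0 w'l w'e]].
exists w'; split=> // [|G g]; last by rewrite w'e eval_subst.
by apply: leq_trans w'l (size_substw _ _) => j; apply: size_theta.
Qed.

Lemma eval_comm_eq1 (K : Type) (G : groupType) (g : K -> G) u v :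
  eval g (commw u v) = 1 <-> commute (eval g u) (eval g v).
Proof.
rewrite eval_comm -invgM mulgA; split=> [/divg1_eq //|->].
exact: mulgV.
Qed.

Section Noncommuting.
Variable G : groupType.
Let W := wreath G (fun _ : unit => intg).

Definition delta1 (x : G) : intg := if x == 1 then 1%R else 0%R.
Definition lamp1 : W := Wreath 1 (fun _ => delta1).

(** The two products have at 1 the lamps [delta1 h] and [delta1 1]. *)
Lemma wbase_lamp1 h : commute (wbase _ h) lamp1 -> h = 1.
Proof.
move=> /(congr1 (fun u => lamps u tt 1)).
rewrite !lampsM /= mul1g mulg1 mul1g /delta1 eqxx.
by case: eqP.
Qed.

(** For [h] different from 1, the lamps of the two products at 1 are minus [delta1 (h * h)] and 1,
    and the former is 0 or -1. *)
Lemma wbase_conj_lamp1 h :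
  commute (wbase _ h) (lamp1 * (wbase _ h * lamp1^-1)) -> h = 1.
Proof.
move=> /(congr1 (fun u => lamps u tt 1)).
rewrite !lampsM !lampsV /= !mul1g ?invg1 ?mulg1 ?mul1g /delta1 eqxx.
by case: (h =P 1) => //= _; case: ifP.
Qed.

End Noncommuting.

Definition law_of_length n (K : Type) (w : seq (K * bool)) : Prop :=
  forall G : groupType, solvable_of_length n G -> forall g : K -> G, eval g w = 1.

Definition somew (K : Type) (w : seq (K * bool)) : seq (option K * bool) :=
  substw (fun j => [:: (Some j, false)]) w.

Lemma eval_somew (K : Type) (G : groupType) (g : option K -> G) w :
  eval g (somew w) = eval (g \o Some) w.
Proof. by rewrite eval_subst; apply: eval_ext => j; rewrite eval_var. Qed.

Lemma size_somew (K : Type) (w : seq (K * bool)) : size (somew w) = size w.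
Proof. by elim: w => [|[x []] w IH] //=; rewrite -IH. Qed.

Definition next_law (K : Type) (w : seq (K * bool)) :=
  commw (somew w) (conjw [:: (None, false)] (somew w)).

Lemma size_next_law (K : Type) (w : seq (K * bool)) :
  size (next_law w) = (4 * (size w).+1)%N.
Proof.
by rewrite size_commw size_conjw size_somew /=; lia.
Qed.

Lemma nontrivial_next_law (K : Type) (w : seq (K * bool)) :
  nontrivial_word w -> nontrivial_word (next_law w).
Proof.
move=> [G [g gw]]; pose W := wreath G (fun _ : unit => intg).
exists W, (fun o => if o is Some j then wbase _ (g j) else lamp1 G).
rewrite eval_comm_eq1 eval_conj eval_var eval_somew.
have -> : eval ((fun o => if o is Some j then wbase _ (g j) else lamp1 G) \o Some) w
    = wbase _ (eval g w) :> W by rewrite (eval_morph _ _ (@wbaseM _ _ _)).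
by move/wbase_conj_lamp1.
Qed.

Lemma law_next_law n (K : Type) (w : seq (K * bool)) :
  law_of_length n w -> law_of_length n.+1 (next_law w).
Proof.
move=> wl G [Q [p [pM [pC sQ]]]] g; rewrite eval_comm_eq1 eval_conj eval_somew.
have p1 : p (eval (g \o Some) w) = 1 by rewrite eval_morph // wl.
by apply: pC; rewrite // !pM p1 mul1g morph_inv // mulgV.
Qed.

(** Commutators lie in the kernel of every homomorphism to Z; on that kernel lamps multiply
    pointwise. *)
Definition bracket (K : Type) (o : option K) : seq ((option K * bool) * bool) :=
  commw [:: ((o, false), false)] [:: ((o, true), false)].

(* Trivial both where w is a law and where the values of the brackets commute. *)
Definition mixed_law (K : Type) (w : seq (K * bool)) :=
  substw (@bracket K) (commw (somew w) [:: (None, false)]).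

Lemma size_mixed_law (K : Type) (w : seq (K * bool)) :
  (size (mixed_law w) <= 4 * (size w).+1.*2)%N.
Proof.
have := size_substw (s := @bracket K) (c := 4)
  (commw (somew w) [:: (None, false)]).
by rewrite size_commw size_somew addn1; apply.
Qed.

(** The commutator of the shift with a step function, equal to [c o] at positive positions and 1
    elsewhere, has lamp [c o] at 0. So the brackets take prescribed values there, chosen so that the
    value of [w] does not commute with a single lamp. *)
Lemma nontrivial_mixed_law (K : Type) (w : seq (K * bool)) :
  nontrivial_word w -> nontrivial_word (mixed_law w).
Proof.
move=> [G [g gw]]; pose W : groupType := wreath G (fun _ : unit => intg).
pose c o : W := if o is Some j then wbase _ (g j) else lamp1 G.
pose step o := @Wreath intg unit (fun _ => W) 1
  (fun _ p => if (p : int) is Posz (S _) then c o else 1).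
exists (wreath intg (fun _ : unit => W)).
exists (fun l => if l.2 then step l.1 else wbase _ (1%R : intg)).
rewrite eval_subst.
move=> /(congr1 (fun u : wreath intg (fun _ : unit => W) => lamps u tt 0%R)).
rewrite lamps_eval => [|o]; last first.
  by rewrite eval_comm !eval_var /= invg1 mulg1 mul1g mulgV.
rewrite (_ : eval _ _ = eval c (commw (somew w) [:: (None, false)])).
  rewrite lamps1 eval_comm_eq1 eval_somew eval_var.
  have -> : eval (c \o Some) w = wbase _ (eval g w).
    by rewrite (eval_morph _ _ (@wbaseM _ _ _)).
  by move/wbase_lamp1.
apply: eval_ext => o; rewrite eval_comm !eval_var /=.
by rewrite invg1 !mulg1 mul1g.
Qed.

Lemma min_natP (A : set nat) :
  (exists n, A n) -> A (min_nat A) /\ forall m, A m -> (min_nat A <= m)%N.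
Proof.
move=> exA; rewrite /min_nat; case: xgetP => [n -> //|/=].
have exA' : exists n, `[< A n >] by case: exA => n An; exists n; apply/asboolP.
case: (ex_minnP exA') => n /asboolP An nmin /(_ n)[]; split=> // m Am.
by apply: nmin; apply/asboolP.
Qed.

Lemma max_natP (A : set nat) b :
  (exists n, A n) -> (forall n, A n -> (n <= b)%N) ->
  A (max_nat A) /\ forall m, A m -> (m <= max_nat A)%N.
Proof.
move=> exA bA; rewrite /max_nat; case: xgetP => [n -> //|/=].
have exA' : exists n, `[< A n >] by case: exA => n An; exists n; apply/asboolP.
have bA' n : `[< A n >] -> (n <= b)%N by move/asboolP/bA.
case: (ex_maxnP exA' bA') => n /asboolP An nmax /(_ n)[]; split=> // m Am.
by apply: nmax; apply/asboolP.
Qed.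

Definition shortest_law n : nat :=
  min_nat [set l | exists2 w : free_group 2,
    nontrivial w /\ law_of_length n (val w) & free_length w = l].

Lemma free_next_law n (u : free_group 2) :
  nontrivial u -> law_of_length n (val u) ->
  exists u' : free_group 2, [/\ nontrivial u', law_of_length n.+1 (val u') &
    (free_length u' <= 24 * (free_length u).+1)%N].
Proof.
move=> u0 ul.
have [//|u' [u'0 u'l u'e]] := @free_theta _ 2 ord0 ord_max (next_law (val u)) isT.
  exact/nontrivial_next_law/free_nontrivial_word.
exists u'; split=> //.
  by move=> G sG g; rewrite [LHS]u'e; apply: law_next_law ul _ sG _.
(* Three variables cost a factor 2 * 3 under [theta], and [next_law] a factor 4, whence 24. *)
by apply: leq_trans u'l _; rewrite size_next_law card_option card_ord mulnA.
Qed.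

Lemma shortest_lawP n :
  (exists2 w : free_group 2,
    nontrivial w /\ law_of_length n (val w) & free_length w = shortest_law n) /\
  (forall w : free_group 2, nontrivial w -> law_of_length n (val w) ->
    (shortest_law n <= free_length w)%N).
Proof.
have [] := @min_natP [set l | exists2 w : free_group 2,
    nontrivial w /\ law_of_length n (val w) & free_length w = l].
  elim: n => [|n [_ [u [u0 ul] _]]].
    exists 1%N, (exist _ [:: (ord0, false)] isT) => //; split=> [//|G G1 g].
    exact: G1.
  by have [u' [u'0 u'l _]] := free_next_law u0 ul; exists (free_length u'), u'.
by move=> H1 H2; split=> // w w0 wl; apply: H2; exists w.
Qed.

(** By residual solvability, a nontrivial word of length at most [n] is not a law for length [n]. *)
Lemma shortest_law_gt n : (n < shortest_law n)%N.
Proof.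
have [[w [w0 wl] <-] _] := shortest_lawP n; rewrite ltnNge; apply/negP => wn.
have [G [g [sG gw]]] := free_nontrivial_solvable w0 wn.
by apply: gw; apply: wl.
Qed.

Lemma shortest_law_mono m n :
  (m <= n)%N -> (shortest_law m <= shortest_law n)%N.
Proof.
move=> mn; have [[w [w0 wl] <-] _] := shortest_lawP n.
by apply: (shortest_lawP m).2 => // G /(solvable_le mn) sG; apply: wl.
Qed.

Lemma shortest_lawS n : (shortest_law n.+1 <= 48 * shortest_law n)%N.
Proof.
have [[w [w0 wl] we] _] := shortest_lawP n.
have [u [u0 ul]] := free_next_law w0 wl.
move=> /(leq_trans ((shortest_lawP n.+1).2 u u0 ul)) /leq_trans; apply.
rewrite we (_ : 48 = 24 * 2)%N // -mulnA leq_mul2l /= mul2n -addnn.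
by rewrite -addn1 leq_add2l; apply: leq_trans (shortest_law_gt n).
Qed.

(** A law in [k] variables becomes, through [theta], a law in two variables that is at most [2 * k]
    times as long. *)
Lemma shorter_not_law (k n : nat) (w : free_group k) :
  nontrivial w -> (2 * k * free_length w < shortest_law n)%N ->
  exists (G : groupType) (g : 'I_k -> G),
    solvable_of_length n G /\ eval g (val w) <> 1.
Proof.
move=> w0 wl; apply: contrapT => H.
have [//|w' [w'0 w'l w'e]] := @free_theta _ 2 ord0 ord_max (val w) isT.
  exact: free_nontrivial_word.
have : (shortest_law n <= free_length w')%N.
  apply: (shortest_lawP n).2 => // G sG g; rewrite [LHS]w'e.
  apply: contrapT => gw; apply: H.
  by exists G, (fun j => eval g (theta ord0 ord_max j)).
by move/leq_trans => /(_ _ w'l); rewrite card_ord leqNgt wl.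
Qed.

(** * The diagonal product *)

Lemma commute_eval (K : Type) (G : groupType) (g : K -> G) z w :
  (forall j, commute (g j) z) -> commute (eval g w) z.
Proof.
move=> gz; elim: w => [|a w IH]; first by rewrite eval_nil; apply/commute_sym/commute1.
rewrite eval_cons; apply/commute_sym/commuteM; last exact/commute_sym.
by rewrite /leval; case: a.2; [apply: commuteV|]; apply/commute_sym.
Qed.

Lemma commute_zexp (G : groupType) (e : G) a b : commute (zexp e a) (zexp e b).
Proof. by rewrite /commute -!zexpM addrC. Qed.

Lemma commute_intg (a b : intg) : commute a b.
Proof. exact: addrC. Qed.

Lemma absz_sub_step (a b e : int) (r : nat) :
  (`|e| <= 1)%N -> (`|a - (b + e)%R| <= r)%N -> (`|a - b| <= r.+1)%N.
Proof. lia. Qed.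

Lemma close_multiples (m m' e r : nat) (p : int) : (r.*2 < e)%N ->
  (`|Posz (m * e) - p| <= r)%N -> (`|Posz (m' * e) - p| <= r)%N -> m = m'.
Proof.
move=> re mr m'r; case: (ltngtP m m') => // lt.
  have : (m.+1 * e <= m' * e)%N by rewrite leq_mul2r lt orbT.
  by rewrite mulSn; lia.
have : (m'.+1 * e <= m * e)%N by rewrite leq_mul2r lt orbT.
by rewrite mulSn; lia.
Qed.

Section DiagonalProduct.
Variables (I : Type) (level : I -> nat) (K : I -> nat) (A : I -> groupType).
Variables (h : forall i, 'I_(K i) -> A i) (d : nat -> nat).
Hypothesis solvableA : forall i, solvable_of_length (level i) (A i).
Hypothesis d_gt0 : forall n, (0 < d n)%N.
Hypothesis d_mono : forall m n, (m <= n)%N -> (d m <= d n)%N.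
Hypothesis d_unbounded : forall N, exists n, (N < d n)%N.

(** The index [None] is the additional factor Z wr Z, which records the exponents. *)
Definition fiber (o : option I) : groupType := if o is Some i then A i else intg.
Definition ambient : groupType := wreath intg fiber.

(* The neutral element of intg is the integer 0: the lamp None is lit at the
   origin. *)
Definition lampa (o : option I) : intg -> fiber o :=
  match o with
  | Some i => spread (@h i) (d (level i))
  | None => fun p => if p == 1 then (1%R : intg) else 1
  end.

Definition gena : ambient := @Wreath intg _ fiber 1 lampa.
Definition gent : ambient := wbase fiber (1%R : intg).
Definition gens (b : bool) : ambient := if b then gent else gena.

Lemma base_gens_step a (p : intg) : exists2 e : int, (`|e| <= 1)%N &
  p * base (leval gens a) = (p + e)%R.
Proof. by case: a => [[] []]; [exists (-1)%R|exists 1%R|exists 0%R|exists 0%R]. Qed.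

(* If q is the only position near p where a has a nontrivial lamp, then w
   multiplies copies of that lamp only, and the coordinate None counts them. *)
Lemma lamps_gens_local i (w : seq (bool * bool)) (p q : intg) :
  (forall p' : intg, p' <> q -> (`|(p' : int) - p| <= size w)%N ->
     lampa (Some i) p' = 1) ->
  lamps (eval gens w) (Some i) p =
    zexp (lampa (Some i) q) (lamps (eval gens w) None (p * q^-1)).
Proof.
elim: w p => [|a w IH] p H; first by rewrite eval_nil.
rewrite eval_cons !lampsM [RHS]zexpM; congr (_ * _); last first.
  rewrite IH ?mulgA => [|p' p'q p'p]; last first.
    apply: H p'q _; move: p'p; have [e e1 ->] := base_gens_step a p.
    exact: absz_sub_step.
  by rewrite -[p * _ * _]mulgA (commute_intg (base _)) mulgA.
have pE : p <> q -> lampa (Some i) p = 1 by move=> pq; apply: H => //; lia.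
case: a {IH H} => [[] []] //; rewrite /leval /gens.
  by rewrite !lampsV /= invg1.
  rewrite !lampsV /= !invg1 !mulg1.
  case: (p =P q) => [->|/[dup] pq /pE /= ->]; first by rewrite mulgV eqxx.
  by rewrite invg1 divg_eq1; move/eqP/negbTE: pq => ->.
rewrite /=.
case: (p =P q) => [->|/[dup] pq /pE /= ->]; first by rewrite mulgV eqxx.
by rewrite divg_eq1; move/eqP/negbTE: pq => ->.
Qed.

Lemma lampa_isolated i (p : intg) r : (r.*2 < d (level i))%N ->
  exists q : intg, forall p' : intg, p' <> q ->
    (`|(p' : int) - p| <= r)%N -> lampa (Some i) p' = 1.
Proof.
move=> rd; have [[q [qr q1]]|H] := pselect (exists q : intg,
    (`|(q : int) - p| <= r)%N /\ lampa (Some i) q <> 1); last first.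
  (* Without a nontrivial lamp in the window any [q] will do. *)
  by exists p => p' _ p'r; apply: contrapT => p'1; apply: H; exists p'.
exists q => p' p'q p'r; apply: contrapT => p'1; apply: p'q.
have [m qE] := spread_neq1 q1; have [m' pE] := spread_neq1 p'1.
suff mm : m = m' by rewrite qE pE mm.
rewrite {}qE {q1} in qr; rewrite {}pE {p'1} in p'r.
exact: close_multiples rd qr p'r.
Qed.

(** A window of radius [r] contains at most one multiple of [d (level i)]. Here [e] and [q] do not
    depend on the word: all short words have at [p] powers of one element, with exponents read off
    from the coordinate [None]. *)
Lemma gens_locally_cyclic i (p : intg) r : (r.*2 < d (level i))%N ->
  exists (e : A i) (q : intg), forall w : seq (bool * bool), (size w <= r)%N ->
    lamps (eval gens w) (Some i) p = zexp e (lamps (eval gens w) None (p * q^-1)).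
Proof.
move=> /(lampa_isolated p)[q qP]; exists (lampa (Some i) q), q => w wr.
by apply: lamps_gens_local => p' p'q p'p; apply: qP p'q (leq_trans p'p wr).
Qed.

Definition gamma_sub : subgroup ambient.
Proof.
exists (fun x => exists w, eval gens w = x).
- by exists [::]; rewrite eval_nil.
- by move=> _ _ [u <-] [v <-]; exists (u ++ v); rewrite eval_cat.
- by move=> _ [u <-]; exists (invw u); rewrite eval_inv.
Defined.

Definition gamma : groupType := sub_group gamma_sub.

Definition gamma_of (w : seq (bool * bool)) : gamma :=
  @InSubgroup _ gamma_sub (eval gens w) (ex_intro _ w erefl).

Definition gamma_gens : set gamma :=
  [set gamma_of [:: (true, false)]; gamma_of [:: (false, false)]]%classic.

Lemma gamma_gens_finite : finite_set gamma_gens.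
Proof. by rewrite /gamma_gens finite_setU; split; apply: finite_set1. Qed.

Lemma gamma_ofP (x : gamma) : exists w, x = gamma_of w.
Proof. by have [w wx] := sub_valP x; exists w; apply: sub_val_inj. Qed.

Lemma is_product_gamma_of w :
  is_product gamma_gens (gamma_of w) [seq gamma_of [:: a] | a <- w].
Proof.
split=> [x /mapP[[b e] _ ->]|].
  have bP : gamma_gens (gamma_of [:: (b, false)]) by case: b; [left|right].
  case: e; last by left.
  right; rewrite (_ : _^-1 = gamma_of [:: (b, false)]) //.
  apply: sub_val_inj => /=; rewrite !eval_cons !eval_nil !mulg1.
  by rewrite /leval /= invgK.
elim: w => [|a w IH]; first by rewrite big_nil; apply: sub_val_inj; apply: eval_nil.
rewrite big_cons -IH; apply: sub_val_inj => /=.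
by rewrite [in RHS]eval_cons eval_nil mulg1 eval_cons.
Qed.

Lemma product_gamma_of g s : is_product gamma_gens g s ->
  exists w, g = gamma_of w /\ size w = size s.
Proof.
move=> [sS ->]; elim: s sS => [|x s IH] sS.
  by exists [::]; split=> //; rewrite big_nil; apply: sub_val_inj; rewrite /= eval_nil.
have [|w [we ws]] := IH; first by move=> y ys; apply: sS; rewrite inE ys orbT.
have [a xa] : exists a, x = gamma_of [:: a].
  have [[->|->]|] := sS x (mem_head x s); [by eexists; reflexivity..|].
  have invE b : x^-1 = gamma_of [:: (b, false)] -> x = gamma_of [:: (b, true)].
    move=> e; apply: invg_inj; rewrite e; apply: sub_val_inj => /=.
    by rewrite !eval_cons !eval_nil !mulg1 /leval /= invgK.
  by move=> [|] /invE ->; eexists; reflexivity.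
exists (a :: w); split; last by rewrite /= ws.
rewrite big_cons we xa; apply: sub_val_inj => /=.
by rewrite eval_cons [in RHS]eval_cons eval_nil mulg1.
Qed.

Lemma gamma_generated : generates gamma_gens.
Proof.
by move=> g; have [w ->] := gamma_ofP g; eexists; apply: is_product_gamma_of.
Qed.

Lemma word_length_gamma_of w : (word_length gamma_gens (gamma_of w) <= size w)%N.
Proof.
have wP : exists2 s : seq gamma, is_product gamma_gens (gamma_of w) s &
    size s = size w.
  by eexists; [apply: is_product_gamma_of|rewrite size_map].
by apply: (min_natP _).2 => //; exists (size w).
Qed.

Lemma word_length_gamma g : exists w, g = gamma_of w /\
  size w = word_length gamma_gens g.
Proof.
have [|[s sP sl] _] := @min_natP [set n | exists2 s : seq gamma,
    is_product gamma_gens g s & size s = n]%classic.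
  by have [s sP] := gamma_generated g; exists (size s), s.
have [w [gw ws]] := product_gamma_of sP.
by exists w; rewrite ws.
Qed.

Lemma solvable_intg : solvable_of_length 1 intg.
Proof.
exists trivial_group, (fun=> 1); split; first by move=> x y; rewrite mulg1.
split; first by move=> x y _ _; apply: commute_intg.
by move=> x; apply: trivial_groupP.
Qed.

Lemma gamma_elementary_amenable : elementary_amenable gamma.
Proof.
pose p (x : gamma) : wreath intg (fun _ : unit => intg) :=
  Wreath (base (sub_val x)) (fun _ => lamps (sub_val x) None).
have pM : {morph p : x y / x * y} by move=> x y; apply: wreathP.
apply: (ea_kernel (pM := pM)); last first.
  apply: (@ea_solvable 2); apply: solvable_wreath; last exact: solvable_intg.
  by move=> _ x y; apply: commute_intg.
set N := sub_group _.
pose val2 (x : N) : ambient := sub_val (sub_val x).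
have base2 (x : N) : base (val2 x) = 1.
  by have := congr1 (@base _ _ _) (sub_valP x).
have lamp2 (x : N) q : lamps (val2 x) None q = 1.
  by have := congr1 (fun u => lamps u tt q) (sub_valP x).
have lamps2M (x y : N) o q :
    lamps (val2 (x * y)) o q = lamps (val2 x) o q * lamps (val2 y) o q.
  by rewrite [LHS]lampsM base2 mulg1.
have lamps2V (x : N) o q : lamps (val2 x^-1) o q = (lamps (val2 x) o q)^-1.
  by rewrite [LHS]lampsV base2 invg1 mulg1.
(* The kernel of [p] is exhausted by the subgroups of elements that vanish in all factors of level
   at least [m]. *)
pose small m (x : N) := forall i, (m <= level i)%N ->
  forall q, lamps (val2 x) (Some i) q = 1.
have small1 m : small m 1 by [].
have smallM m x y : small m x -> small m y -> small m (x * y).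
  by move=> sx sy i im q; rewrite lamps2M sx // sy // mulg1.
have smallV m x : small m x -> small m x^-1.
  by move=> sx i im q; rewrite lamps2V sx // invg1.
pose S m := Subgroup (small1 m) (@smallM m) (@smallV m).
apply: (ea_directed_union (S := S)).
- move=> m n; exists (maxn m n); split=> x sx i; rewrite geq_max => /andP[mi ni];
    exact: sx.
- move=> x; have [w xw] := gamma_ofP (sub_val x).
  have [n wn] := d_unbounded (size w).*2.
  exists n => i ni q.
  (* At these levels the lamp is a power of [e] whose exponent is a value of the coordinate [None],
     hence 0 on the kernel. *)
  have [e [q' H]] := gens_locally_cyclic q (leq_trans wn (d_mono ni)).
  have := lamp2 x (q * q'^-1); rewrite /val2 xw /= H // => ->.
  by [].
move=> m; apply: (@ea_solvable m).
(* Such an element is determined by its lamps of level below [m], which lie in groups solvable of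
   length [m]. *)
pose J := {iq : I * intg | (level iq.1 < m)%N}.
apply: (@solvable_separated _ _ J (fun j => A (sval j).1)
  (fun j x => lamps (val2 (sub_val x)) (Some (sval j).1) (sval j).2)).
- by move=> j x y; rewrite [LHS]lamps2M.
- move=> x x1; apply: sub_val_inj; apply: sub_val_inj; apply: sub_val_inj.
  apply: wreathP => [|[i|] q]; [exact: base2| |exact: lamp2].
  have [im|im] := ltnP (level i) m; last exact: (sub_valP x).
  exact: (x1 (exist _ (i, q) im)).
- by move=> [[i q] im] /=; apply: solvable_le (ltnW im) (solvableA i).
Qed.

Lemma gamma_witness i (w : free_group (K i)) : eval (@h i) (val w) <> 1 ->
  exists2 g : 'I_(K i) -> gamma, word_eval w g <> 1 &
    (\sum_(j < K i) word_length gamma_gens (g j) <=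
       K i * (2 * K i * d (level i)).+1)%N.
Proof.
move=> hw; set D := d (level i).
(* Conjugating [gena] by the power [j * D] of the shift brings its lamp [h j] to the origin. *)
pose v (j : 'I_(K i)) : seq (bool * bool) :=
  conjw (nseq (enum_rank j * D) (true, false)) [:: (false, false)].
exists (fun j => gamma_of (v j)).
  move=> /(congr1 (@sub_val _ _)).
  rewrite -/(eval _ _) (eval_morph _ _ (@sub_valM _ gamma_sub)).
  move=> /(congr1 (fun u : ambient => lamps u (Some i) 1)).
  rewrite lamps_eval => [|j]; last first.
    by rewrite /= eval_conj eval_nseq eval_var -wbaseX /= mul1g mulgV.
  rewrite lamps1 => e; apply: hw; rewrite -[RHS]e; apply: eval_ext => j /=.
  rewrite eval_conj eval_nseq eval_var -wbaseX lamps_conj mul1g intg_exp /=.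
  by rewrite spreadE.
rewrite -[X in (_ <= X * _)%N](card_ord (K i)) -sum_nat_const leq_sum // => j _.
apply: leq_trans (word_length_gamma_of _) _.
rewrite size_conjw size_nseq addn1 ltnS -mul2n -mulnA leq_mul2l leq_mul2r /=.
by apply/orP; right; rewrite -[X in (_ <= X)%N]card_ord ltnW.
Qed.

Lemma mixed_law_vanishes (k n R : nat) (u : seq (letter 2)) (x y : 'I_k)
    (g : 'I_k -> gamma) :
  law_of_length n u -> (96 * R < d n.+1)%N ->
  (\sum_(j < k) word_length gamma_gens (g j) <= R)%N ->
  eval (fun j => eval g (theta x y j)) (mixed_law u) = 1.
Proof.
move=> ul Rd gR.
have [W WP] := choice (fun j => word_length_gamma (g j)).
have WR j : (size (W j) <= R)%N.
  rewrite (WP j).2; apply: leq_trans gR.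
  by rewrite (bigD1 j) //= leq_addr.
pose Z (o : option 'I_2) := substw W (substw (theta x y) (bracket o)).
(* A bracket has 4 letters, and [theta] on its 6 variables costs a factor 2 * 6. The window of
   radius [48 * R] requires [96 * R < d n.+1]. *)
have ZR o : (size (Z o) <= 48 * R)%N.
  rewrite mulnC; apply: leq_trans (size_substw _ WR) _.
  rewrite leq_mul2l; apply/orP; right.
  apply: leq_trans (size_substw _ (@size_theta _ _ x y)) _.
  by rewrite card_prod card_option card_bool card_ord.
rewrite eval_subst; apply: sub_val_inj; rewrite (eval_morph _ _ (@sub_valM _ _)).
rewrite (eval_ext (h := fun o => eval gens (Z o))); last first.
  move=> o /=; rewrite -eval_subst (eval_morph _ _ (@sub_valM _ _)).
  by rewrite [RHS]eval_subst; apply: eval_ext => j /=; rewrite {1}(WP j).1.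
have Z1 o : base (eval gens (Z o)) = 1.
  rewrite base_eval !eval_subst.
  apply/eval_comm_eq1; exact: commute_intg.
apply: wreathP => [|o' p].
  rewrite base_eval; apply/eval_comm_eq1; exact: commute_intg.
rewrite lamps_eval // [RHS]lamps1; apply/eval_comm_eq1; rewrite eval_somew eval_var.
case: o' => [i|]; last exact: commute_intg.
(* Up to level [n] the law [u] makes the first entry of the commutator trivial; above it, all
   brackets have powers of one [e] as lamps at [p]. *)
have [ni|ni] := leqP (level i) n.
  by rewrite ul; [apply: commute_sym; apply: commute1|apply: solvable_le ni (solvableA i)].
have [|e [q H]] := @gens_locally_cyclic i p (48 * R).
  by rewrite -mul2n mulnA; apply: leq_trans Rd (d_mono ni).
apply: commute_eval => j /=; rewrite !H //; exact: commute_zexp.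
Qed.

End DiagonalProduct.

(** * Realisation of a prescribed growth *)

Lemma solvable_witness (n k : nat) (w : free_group k) :
  exists (G : groupType) (g : 'I_k -> G), solvable_of_length n G /\
    ((exists (G' : groupType) (g' : 'I_k -> G'),
       solvable_of_length n G' /\ eval g' (val w) <> 1) -> eval g (val w) <> 1).
Proof.
have [[G [g [sG gw]]]|H] := pselect (exists (G : groupType) (g : 'I_k -> G),
    solvable_of_length n G /\ eval g (val w) <> 1); first by exists G, g.
(* The trivial group serves as default for laws, so that the factors can be indexed by all triples
   of [k], [n] and [w]. *)
exists trivial_group, (fun=> 1); split=> //.
by apply: (@solvable_le 0) => // x; apply: trivial_groupP.
Qed.

(** The last two properties give the upper and the lower bound on the growth; [d] is still arbitrary
    here. *)
Lemma exists_lawless_group (d : nat -> nat) :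
  (forall n, (0 < d n)%N) -> (forall m n, (m <= n)%N -> (d m <= d n)%N) ->
  (forall N, exists n, (N < d n)%N) ->
  exists (G : groupType) (S : set G),
    [/\ finite_set S, generates S, elementary_amenable G,
      forall (k n : nat) (w : free_group k), nontrivial w ->
        (2 * k * free_length w < shortest_law n)%N ->
        exists2 g : 'I_k -> G, word_eval w g <> 1 &
          (\sum_(i < k) word_length S (g i) <= k * (2 * k * d n).+1)%N &
      forall k n : nat, (2 <= k)%N -> exists2 w : free_group k,
        nontrivial w /\ (free_length w <= 192 * shortest_law n)%N &
        forall g : 'I_k -> G, (96 * \sum_(i < k) word_length S (g i) < d n.+1)%N ->
          word_eval w g = 1].
Proof.
move=> d_gt0 d_mono d_unb.
pose I := {k : nat & (nat * free_group k)%type}.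
pose level (i : I) := (projT2 i).1.
pose K (i : I) := projT1 i.
pose A (i : I) := sval (cid (solvable_witness (level i) (projT2 i).2)).
pose h i : 'I_(K i) -> A i :=
  sval (cid (svalP (cid (solvable_witness (level i) (projT2 i).2)))).
have hP i : solvable_of_length (level i) (A i) /\ _ :=
  svalP (cid (svalP (cid (solvable_witness (level i) (projT2 i).2)))).
pose S := @gamma_gens I level K A h d.
exists (gamma level h d), S; split.
- exact: gamma_gens_finite.
- exact: gamma_generated.
- by apply: gamma_elementary_amenable => // i; have [] := hP i.
- move=> k n w w0 wn; pose i : I := existT _ k (n, w).
  have hw : eval (@h i) (val w) <> 1.
    by apply: (hP i).2; apply: shorter_not_law w0 wn.
  exact: (gamma_witness level d_gt0 hw).
move=> k n k2; have [[u [u0 ul] un] _] := shortest_lawP n.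
pose x : 'I_k := Ordinal (ltnW k2); pose y : 'I_k := Ordinal k2.
have xy : x != y by [].
have [w [w0 wl we]] := free_theta xy
  (nontrivial_mixed_law (free_nontrivial_word u0)).
exists w; first split=> //.
  apply: leq_trans wl _; rewrite card_prod card_option card_bool card_ord.
  (* The factor 12 comes from [theta] on 6 variables. The total [96 * (free_length u).+1] is at most
     [192 * free_length u], as [u] is not empty. *)
  apply: (@leq_trans (12 * (4 * (free_length u).+1.*2))%N).
    by rewrite leq_mul2l size_mixed_law.
  have := shortest_law_gt n; rewrite -un; lia.
move=> g gd; rewrite we; apply: mixed_law_vanishes ul gd (leqnn _) => //.
by move=> i; have [] := hP i.
Qed.

Lemma shortest_law0 : (shortest_law 0 <= 1)%N.
Proof.
pose x : free_group 2 := exist _ [:: (ord0, false)] isT.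
by apply: ((shortest_lawP 0).2 x) => // G G1 g; apply: G1.
Qed.

Local Close Scope group_scope.

Theorem theorem1p1 (f : nat -> nat)
  (f_pos : forall n : nat, 0 < n -> 0 < f n)
  (f_unbounded : forall N : nat, exists n : nat, 0 < n /\ N < f n)
  (f_nondecreasing : forall m n : nat, 0 < m -> m <= n -> f m <= f n)
  (f_M : exists M : nat, 2 <= M /\
    forall n : nat, 0 < n -> M * f n <= f (M * n)) :
  exists (G : groupType) (S : set G),
    finite_set S /\ generates S /\ elementary_amenable G /\ lawless G /\
    forall k : nat, 2 <= k -> growth_equiv (lawlessness_growth S k) f.
Proof.
have law_gt0 n : 0 < shortest_law n := leq_ltn_trans (leq0n n) (shortest_law_gt n).
have [|||G [S [finS genS eaG upper lower]]] :=
  @exists_lawless_group (fun n => f (shortest_law n)).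
- by move=> n; apply: f_pos.
- by move=> m n mn; apply: f_nondecreasing => //; apply: shortest_law_mono.
- move=> N; have [n [n0 Nn]] := f_unbounded N; exists n.
  by apply: leq_trans Nn (f_nondecreasing _ _ n0 _); apply/ltnW/shortest_law_gt.
have chi_le k (w : free_group k) (g : 'I_k -> G) : word_eval w g <> 1%g ->
    chi S w <= \sum_(i < k) word_length S (g i).
  by move=> wg; apply: (min_natP _).2; [eexists; exists g|exists g].
(* Level [2 * k * n] suffices for all words of length at most [n], because L(m) > m. *)
have law_gt k l n : l <= n -> 2 * k * l < shortest_law (2 * k * n).
  by move=> ln; apply: leq_ltn_trans (shortest_law_gt _); rewrite leq_mul2l ln orbT.
have growthP k l : 2 <= k -> 0 < l ->
    (exists2 w : free_group k, nontrivial w /\ free_length w <= l &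
      chi S w = lawlessness_growth S k l) /\
    (forall w : free_group k, nontrivial w -> free_length w <= l ->
      chi S w <= lawlessness_growth S k l).
  move=> k2 l0.
  (* An explicit bound on [chi] over words of length at most [l] shows that the maximum exists and
     is not the default 0. *)
  have [||H1 H2] := @max_natP [set n | exists2 w : free_group k,
      nontrivial w /\ (free_length w <= l)%N & chi S w = n]%classic
      (k * (2 * k * f (shortest_law (2 * k * l))).+1).
  - pose x : free_group k := exist _ [:: (Ordinal (ltnW k2), false)] isT.
    by exists (chi S x), x.
  - move=> _ [w [w0 wl] <-].
    have [g wg gb] := upper _ _ w w0 (law_gt k _ _ wl).
    by apply: leq_trans (chi_le _ _ _ wg) gb.
  by split=> // w w0 wl; apply: H2; exists w.
exists G, S; split=> //; split=> //; split=> //; split.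
  exists 2; split=> // w [w0 wl].
  by have [g + _] := upper _ _ w w0 (law_gt 2 _ _ (leqnn _)); apply.
move=> k k2; split.
  (* One constant for two uses: [96 * k] inside the argument of [f], from L(n+1) <= 48 L(n) <= 48 *
     (2 * k * l), and [k * (2 * k + 1)] as the factor in front. *)
  exists (96 * k + k * (2 * k + 1)); split; first by lia.
  move=> l l0; have [[w [w0 wl] <-] _] := growthP k l k2 l0.
  have exn : exists n, 2 * k * l < shortest_law n.
    by exists (2 * k * l); apply: law_gt.
  (* The least level whose shortest law exceeds [2 * k * l] is not 0, since L(0) <= 1; so it has a
     predecessor with L(n) <= [2 * k * l]. *)
  case: (ex_minnP exn) => -[|n] ln nmin.
    by have := leq_trans ln shortest_law0; lia.
  have nl : shortest_law n <= 2 * k * l.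
    by rewrite leqNgt; apply/negP => /nmin; rewrite ltnn.
  have [|g wg gb] := upper _ n.+1 w w0.
    by apply: leq_ltn_trans ln; rewrite leq_mul2l wl orbT.
  apply: leq_trans (chi_le _ _ _ wg) (leq_trans gb _).
  set K := 96 * k + _.
  have fK : f (shortest_law n.+1) <= f (K * l).
    apply: f_nondecreasing => //; apply: leq_trans (shortest_lawS n) _.
    apply: (@leq_trans (48 * (2 * k * l))); first by rewrite leq_mul2l nl.
    by rewrite !mulnA leq_mul2r leq_addr orbT.
  have fK0 : 0 < f (K * l) by apply: leq_trans fK; apply: f_pos.
  apply: (@leq_trans (k * (2 * k + 1) * f (K * l))); last first.
    by rewrite leq_mul2r leq_addl orbT.
  rewrite -[X in _ <= X]mulnA leq_mul2l; apply/orP; right.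
  by rewrite mulnDl mul1n -addn1 leq_add // leq_mul2l fK orbT.
exists 192; split=> // l l0.
have exn : exists n, shortest_law n <= l.
  by exists 0; apply: leq_trans shortest_law0 l0.
have bn n : shortest_law n <= l -> n <= l.
  by move=> nl; apply: ltnW; apply: leq_trans (shortest_law_gt n) nl.
(* For the largest [n] with L(n) <= [l] one has [f l] <= f(L(n+1)), and the word [w] below has
   length at most 192 L(n) <= [192 * l]. *)
case: (ex_maxnP exn bn) => n nl nmax.
have ln : l < shortest_law n.+1.
  by rewrite ltnNge; apply/negP => /nmax; rewrite ltnn.
have [w [w0 wl] w1] := lower k n k2.
(* Since [w] is not a law, the minimum [chi S w] is attained; on a tuple attaining it,
   [96 * chi S w < f (shortest_law n.+1)] would make [w] trivial. *)
have [g gw ge] : exists2 g : 'I_k -> G, word_eval w g <> 1%g &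
    \sum_(i < k) word_length S (g i) = chi S w.
  have [g gw _] := upper _ _ w w0 (law_gt k _ _ (leqnn _)).
  have [|H _] := @min_natP [set n | exists2 g : 'I_k -> G,
    word_eval w g <> 1%g & \sum_(i < k) word_length S (g i) = n]%classic;
    last exact: H.
  by eexists; exists g.
apply: leq_trans (f_nondecreasing _ _ l0 (ltnW ln)) _.
apply: (@leq_trans (96 * chi S w)).
  by rewrite leqNgt; apply/negP; rewrite -ge => /w1.
apply: leq_mul => //; apply: (growthP _ _ k2 _).2 => //; first by rewrite muln_gt0.
by apply: leq_trans wl _; rewrite leq_mul2l nl.
Qed.
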